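(* Let $(A,\mu,\alpha)$ be a Hom-alternative algebra such that $\alpha$ is invertible. Then $(A,\mu,\alpha)$ is solvable if and only if its induced alternative algebra $(A,\mu')$, $\mu'=\alpha^{-1}\circ\mu$, is solvable.
   Context: All vector spaces are over a fixed field $\mathbb{K}$ of characteristic $0$. A Hom-algebra is a triple $(A,\mu,\alpha)$ with $A$ a vector space, $\mu:A\otimes A\to A$ linear and $\alpha:A\to A$ linear; it is multiplicative if $\alpha\circ\mu=\mu\circ(\alpha\otimes\alpha)$. Its Hom-associator is $as_A(x,y,z)=\mu(\mu(x,y),\alpha(z))-\mu(\alpha(x),\mu(y,z))$. A Hom-alternative algebra is a multiplicative Hom-algebra with $as_A(x,x,y)=0$ and $as_A(x,y,y)=0$ for all $x,y\in A$. If $\alpha$ is invertible, then $(A,\mu'=\alpha^{-1}\circ\mu)$ is an alternative algebra, called the induced alternative algebra. The derived sequence of $(A,\mu,\alpha)$ is $A^{(0)}=A$, $A^{(k)}=\mu(A^{(k-1)},A^{(k-1)})$ for $k\ge 1$ (where $\mu(U,W)$ denotes the span of the products), and $(A,\mu,\alpha)$ is solvable if $A^{(n)}=\{0\}$ for some integer $n\ge 1$. Solvability of $(A,\mu')$ is defined in the same way with $\mu'$ in place of $\mu$. *)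

(* Defs.v *)
From mathcomp Require Import all_boot all_order all_algebra.

Set Implicit Arguments.
Unset Strict Implicit.
Unset Printing Implicit Defensive.

Import GRing.Theory.
Local Open Scope ring_scope.

Section HomAlternative.
Variables (K : fieldType) (A : lmodType K).

Definition multiplicative_twist (mu : A -> A -> A) (alpha : A -> A) : Prop :=
  forall x y, alpha (mu x y) = mu (alpha x) (alpha y).

Definition hom_associator (mu : A -> A -> A) (alpha : A -> A) (x y z : A) : A :=
  mu (mu x y) (alpha z) - mu (alpha x) (mu y z).

Record hom_alternative (mu : {bilinear A -> A -> A}) (alpha : {linear A -> A})
    : Prop := HomAlternative {
  hom_alternative_mult : multiplicative_twist mu alpha;
  hom_alternative_left : forall x y, hom_associator mu alpha x x y = 0;
  hom_alternative_right : forall x y, hom_associator mu alpha x y y = 0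
}.

(* [alphaV] stands for the inverse of the twisting map. *)
Definition induced_mul (alphaV : A -> A) (mu : A -> A -> A) (x y : A) : A :=
  alphaV (mu x y).

Definition span (S : A -> Prop) (x : A) : Prop :=
  exists (n : nat) (c : 'I_n -> K) (v : 'I_n -> A),
    (forall i, S (v i)) /\ x = \sum_(i < n) c i *: v i.

Definition products (mu : A -> A -> A) (U W : A -> Prop) (x : A) : Prop :=
  exists u w, [/\ U u, W w & x = mu u w].

Fixpoint derived (mu : A -> A -> A) (k : nat) : A -> Prop :=
  if k is k'.+1 then span (products mu (derived mu k') (derived mu k'))
  else fun _ => True.

Definition solvable_mul (mu : A -> A -> A) : Prop :=
  exists n : nat, (1 <= n)%N /\ forall x, derived mu n x <-> x = 0.

End HomAlternative.

(* Main.v *)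
From HB Require Import structures.
Require Import Defs.
From mathcomp Require Import all_boot all_order all_algebra.

(** The two derived sequences coincide term by term, not only their vanishing.
    Since [alpha] is a bijective morphism of [mu], so is its inverse [alphaV],
    and every term of the derived sequence of [mu] is mapped into itself by any
    linear morphism of [mu] ([derived_morph]), hence by both [alpha] and
    [alphaV].  On a subset [U] stable under both maps, the products for [mu] and
    for [alphaV \o mu] are the same elements:
      [alphaV (mu u w) = mu (alphaV u) (alphaV w)] and
      [mu u w = alphaV (mu (alpha u) (alpha w))].
    Induction on the length of the sequence then gives the equality of the
    derived sequences ([derived_induced]). *)

Import GRing.Theory.
Local Open Scope ring_scope.

Lemma span_image (K : fieldType) (A : lmodType K) (f : {linear A -> A})
    (S T : A -> Prop) :
  (forall x, S x -> T (f x)) -> forall x, Defs.span S x -> Defs.span T (f x).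
Proof.
move=> ST x [n [c [v [Sv ->]]]]; exists n, c, (f \o v).
split=> [i|]; first exact/ST/Sv.
by rewrite linear_sum; apply: eq_bigr => i _; rewrite linearZ.
Qed.

Lemma span_mono (K : fieldType) (A : lmodType K) (S T : A -> Prop) :
  (forall x, S x -> T x) -> forall x, Defs.span S x -> Defs.span T x.
Proof. exact: (@span_image K A idfun). Qed.

(** Induction on [k]: a morphism sends a product of two elements of the previous
    term to the product of their images, and linearity carries this over to the
    span. *)
Lemma derived_morph (K : fieldType) (A : lmodType K) (mu : A -> A -> A)
    (f : {linear A -> A}) :
  multiplicative_twist mu f ->
  forall k x, derived mu k x -> derived mu k (f x).
Proof.
move=> fM; elim=> [//|k IHk] x /=; apply: span_image => _ [u [w [Du Dw ->]]].
by exists (f u), (f w); split; [exact: IHk | exact: IHk | exact: fM].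
Qed.

Lemma multiplicative_twist_can (A : Type) (mu : A -> A -> A)
    (f g : A -> A) :
  cancel f g -> cancel g f ->
  (forall x y, f (mu x y) = mu (f x) (f y)) ->
  forall x y, g (mu x y) = mu (g x) (g y).
Proof. by move=> fK gK fM x y; rewrite -{1}[x]gK -{1}[y]gK -fM fK. Qed.

(** The factors of a product for one multiplication have to be moved by [alphaV]
    or [alpha] to become factors for the other; [derived_morph] keeps them in the
    same term of the sequence. *)
Lemma derived_induced (K : fieldType) (A : lmodType K) (mu : A -> A -> A)
    (alpha alphaV : {linear A -> A}) :
  cancel alpha alphaV -> cancel alphaV alpha -> multiplicative_twist mu alpha ->
  forall k x, derived (induced_mul alphaV mu) k x <-> derived mu k x.
Proof.
move=> alphaK alphaVK alphaM.
have alphaVM : multiplicative_twist mu alphaV.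
  exact: multiplicative_twist_can alphaK alphaVK alphaM.
elim=> [//|k IHk] x /=; split; apply: span_mono => _ [u [w [Du Dw ->]]].
  exists (alphaV u), (alphaV w); split; last exact: alphaVM.
  - exact/derived_morph/IHk.
  - exact/derived_morph/IHk.
exists (alpha u), (alpha w); split.
- exact/IHk/derived_morph.
- exact/IHk/derived_morph.
- by rewrite /induced_mul -alphaM alphaK.
Qed.

Local Close Scope ring_scope.

Theorem theorem4p3 (K : fieldType) (charK : [pchar K]%R =i pred0)
    (A : lmodType K) (mu : {bilinear A -> A -> A}%R) (alpha : {linear A -> A}%R)
    (Aalt : hom_alternative mu alpha)
    (alphaV : A -> A)
    (alphaK : cancel alpha alphaV) (alphaVK : cancel alphaV alpha) :
  solvable_mul mu <-> solvable_mul (induced_mul alphaV mu).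
Proof.
have alphaV_lin := can2_linear alphaK alphaVK.
pose g : {linear A -> A}%R :=
  HB.pack alphaV (GRing.isLinear.Build K A A _ alphaV alphaV_lin).
have DE := @derived_induced K A mu alpha g alphaK alphaVK
             (hom_alternative_mult Aalt).
by split=> -[n [n_gt0 Dn]]; exists n; split=> // x; apply: iff_trans (Dn x);
  [|apply: iff_sym]; exact: DE.
Qed.
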